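(* Let $\Omega\subset\mathbb{C}^n$ be a bounded domain. Then for every $z\in\Omega$: (a) $T_\Omega(z)\ge \dfrac{1}{\sqrt n}\,S_\Omega(z)$; (b) $S_\Omega(z)\ge \dfrac{1}{\sqrt n}\,T_\Omega(z)$.
   Context: $\mathbb{B}^n(0,r)$ is the open Euclidean ball of radius $r$ centered at the origin of $\mathbb{C}^n$, and $\mathbb{B}^n=\mathbb{B}^n(0,1)$. $\mathbb{D}^n(0,r)=\{w\in\mathbb{C}^n: |w_i|<r,\ 1\le i\le n\}$ is the open polydisk of radius $r$ centered at the origin, and $\mathbb{D}^n=\mathbb{D}^n(0,1)$. A holomorphic embedding is an injective holomorphic map. For a bounded domain (connected open set) $\Omega\subseteq\mathbb{C}^n$ and $z\in\Omega$: $S_\Omega(z)=\sup_f \sup\{r>0:\mathbb{B}^n(0,r)\subseteq f(\Omega)\}$, the outer supremum being over holomorphic embeddings $f:\Omega\to\mathbb{B}^n$ with $f(z)=0$ (squeezing function corresponding to the unit ball); $T_\Omega(z)=\sup_f \sup\{r>0:\mathbb{D}^n(0,r)\subseteq f(\Omega)\}$, the outer supremum being over holomorphic embeddings $f:\Omega\to\mathbb{D}^n$ with $f(z)=0$ (squeezing function corresponding to the polydisk). *)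

(* Defs.v *)
From HB Require Import structures.
From mathcomp Require Import all_boot all_order all_algebra.
From mathcomp Require Import complex.
From mathcomp Require Import all_classical all_reals all_analysis.

Set Implicit Arguments.
Unset Strict Implicit.
Unset Printing Implicit Defensive.

Import Order.TTheory GRing.Theory Num.Theory.
Import numFieldNormedType.Exports.

Local Open Scope classical_set_scope.
Local Open Scope ring_scope.

(* The topology of the complex plane, induced by the modulus. *)
HB.instance Definition _ (R : realType) := PseudoMetric.copy R[i] R[i]^o.

(* C^n is 'rV[R[i]]_n.  The library's norm on it is the sup norm with values in
   R[i]; it is used below only through the topology and the notions of
   boundedness and differentiability it induces, which are the usual ones. *)

Definition euclidean_norm (R : realType) (n : nat) (w : 'rV[R[i]]_n) : R :=
  Num.sqrt (\sum_(i < n) ComplexField.Normc.normc (w ord0 i) ^+ 2).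

Definition euclidean_ball (R : realType) (n : nat) (r : R) : set 'rV[R[i]]_n :=
  [set w | euclidean_norm w < r].

Definition polydisk (R : realType) (n : nat) (r : R) : set 'rV[R[i]]_n :=
  [set w | forall i : 'I_n, ComplexField.Normc.normc (w ord0 i) < r].

Definition bounded_domain (R : realType) (n : nat) (Om : set 'rV[R[i]]_n) :
  Prop := [/\ open Om, connected Om, Om !=set0 & bounded_set Om].

(* The scalar field is R[i], so [differentiable] is complex differentiability.
   A map on an open set Om is represented by a total function, whose values
   outside Om are irrelevant. *)
Definition holomorphic_on (R : realType) (n : nat) (Om : set 'rV[R[i]]_n)
    (f : 'rV[R[i]]_n -> 'rV[R[i]]_n) : Prop :=
  forall z, Om z -> differentiable f z.

Definition holomorphic_embedding (R : realType) (n : nat)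
    (Om D : set 'rV[R[i]]_n) (f : 'rV[R[i]]_n -> 'rV[R[i]]_n) : Prop :=
  [/\ holomorphic_on Om f, set_inj Om f & f @` Om `<=` D].

(* Squeezing function of Om for a family of model domains [D r] of radius r.
   The suprema are taken in the extended reals. *)
Definition squeezing (R : realType) (n : nat) (D : R -> set 'rV[R[i]]_n)
    (Om : set 'rV[R[i]]_n) (z : 'rV[R[i]]_n) : \bar R :=
  ereal_sup
    [set ereal_sup [set r%:E | r in [set r : R | 0 < r /\ D r `<=` f @` Om]]
      | f in [set f | holomorphic_embedding Om (D 1) f /\ f z = 0]].

Definition ball_squeezing (R : realType) (n : nat) :=
  @squeezing R n (@euclidean_ball R n).

Definition polydisk_squeezing (R : realType) (n : nat) :=
  @squeezing R n (@polydisk R n).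

(* Main.v *)
(** The Euclidean and sup norms on C^n satisfy |w|_oo <= |w|_2 <= sqrt n |w|_oo,
    so an embedding into the ball is one into the polydisk, and an embedding
    into the polydisk becomes one into the ball after division by sqrt n. *)
Require Import Defs.
From HB Require Import structures.
From mathcomp Require Import all_boot all_order all_algebra.
From mathcomp Require Import complex.
From mathcomp Require Import all_classical all_reals all_analysis.

Set Implicit Arguments.
Unset Strict Implicit.
Unset Printing Implicit Defensive.

Import Order.TTheory GRing.Theory Num.Theory.
Import numFieldNormedType.Exports.

Local Open Scope classical_set_scope.
Local Open Scope ring_scope.

(** Composing an embedding [f] with the dilation by [k] gives a competitor for [E]: the third
    hypothesis keeps its image in [E 1], and the fourth turns each [D r] inside the image of [f]
    into [E (c * r)] inside the dilated image. Both inequalities are instances, with the same [c]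
    but different [k]. *)
Lemma squeezing_scale_le (R : realType) (n : nat) (D E : R -> set 'rV[R[i]]_n)
    (k c : R) (Om : set 'rV[R[i]]_n) (z : 'rV[R[i]]_n) :
    k != 0 -> 0 < c ->
    (forall w, D 1 w -> E 1 (k%:C%C *: w)) ->
    (forall r w, 0 < r -> E (c * r) w -> D r (k^-1%:C%C *: w)) ->
  (c%:E * squeezing D Om z <= squeezing E Om z)%E.
Proof.
move=> k0 c0 DE ED.
have kC0 : k%:C%C != 0 :> R[i] by rewrite fmorph_eq0.
(* Moving [c] to the right leaves bare suprema on the left, so one [f] and then one [r] can be
   treated at a time. *)
rewrite -lee_pdivlMl //; apply: ge_ereal_sup => _ [f [[fhol finj fD] fz0] <-].
apply: ge_ereal_sup => _ [r [r0 Dr] <-].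
rewrite lee_pdivlMl // -EFinM.
(* The intermediate value is the inner supremum attached to the dilated embedding. *)
apply: (@le_trans _ _ (ereal_sup [set s%:E | s in
    [set s | 0 < s /\ E s `<=` (fun x => k%:C%C *: f x) @` Om]])).
  apply: ereal_sup_ubound; exists (c * r) => //=; split; first exact: mulr_gt0.
  move=> w /(ED _ _ r0) /Dr [x Omx fx]; exists x => //.
  by rewrite fx scalerA fmorphV divff // scale1r.
apply: ereal_sup_ubound; exists (fun x => k%:C%C *: f x) => //=.
split; last by rewrite fz0 scaler0.
split.
- by move=> x Omx; apply: differentiableZ; exact: fhol.
- by move=> x y Omx Omy /(scalerI kC0); exact: finj.
- by move=> _ [x Omx <-]; apply/DE/fD; exists x.
Qed.

Lemma normc_ge0 (R : realType) (x : R[i]) : 0 <= ComplexField.Normc.normc x.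
Proof. by case: x => a b; exact: sqrtr_ge0. Qed.

Lemma normc_le_euclidean_norm (R : realType) (n : nat) (w : 'rV[R[i]]_n) i :
  ComplexField.Normc.normc (w ord0 i) <= euclidean_norm w.
Proof.
rewrite -[leLHS]ger0_norm ?normc_ge0 // -sqrtr_sqr.
apply: ler_wsqrtr; rewrite (bigD1 i) //= lerDl.
by apply: sumr_ge0 => j _; exact: sqr_ge0.
Qed.

Lemma euclidean_norm_lt (R : realType) (n : nat) (r : R) (w : 'rV[R[i]]_n) :
  (0 < n)%N -> 0 < r -> polydisk r w -> euclidean_norm w < Num.sqrt n%:R * r.
Proof.
move=> n0 r0 wr.
(* Writing [r] as the root of [r ^+ 2] puts both sides under a root; what remains compares two sums
   of [n] terms. *)
rewrite -[X in _ * X](ger0_norm (ltW r0)) -sqrtr_sqr -sqrtrM //.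
rewrite ltr_sqrt; last by rewrite mulr_gt0 ?ltr0n ?exprn_gt0.
rewrite mulr_natl -[X in _ *+ X]card_ord -sumr_const.
apply: ltr_sum => [|i _].
  (* Termwise strictness passes to the sums only because the index set is nonempty. *)
  by apply/hasP; exists (Ordinal n0) => //; rewrite mem_index_enum.
by rewrite ltr_pXn2r ?nnegrE ?normc_ge0 ?(ltW r0) ?wr.
Qed.

Lemma normcZ_real (R : realType) (n : nat) (k : R) (w : 'rV[R[i]]_n) i : 0 <= k ->
  ComplexField.Normc.normc ((k%:C%C *: w) ord0 i)
  = k * ComplexField.Normc.normc (w ord0 i).
Proof.
move=> k0; rewrite mxE ComplexField.Normc.normcM /ComplexField.Normc.normc /=.
by rewrite [in 0 ^+ 2]expr0n addr0 sqrtr_sqr ger0_norm.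
Qed.

Lemma euclidean_ball_sub_polydisk (R : realType) (n : nat) (r : R) :
  @euclidean_ball R n r `<=` @polydisk R n r.
Proof. by move=> w wr i; apply: le_lt_trans (normc_le_euclidean_norm w i) wr. Qed.

Theorem lemma1p2 (R : realType) (n : nat) (n_gt0 : (0 < n)%N)
    (Om : set 'rV[R[i]]_n) (Om_dom : bounded_domain Om)
    (z : 'rV[R[i]]_n) (Om_z : Om z) :
  ((1 / Num.sqrt (n%:R : R))%R%:E * ball_squeezing Om z
     <= polydisk_squeezing Om z)%E /\
  ((1 / Num.sqrt (n%:R : R))%R%:E * polydisk_squeezing Om z
     <= ball_squeezing Om z)%E.
Proof.
rewrite div1r; set s := Num.sqrt _.
have s0 : 0 < s by rewrite sqrtr_gt0 ltr0n.
have sV0 : 0 < s^-1 by rewrite invr_gt0.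
split.
(* No dilation here: the factor [s^-1] is lost only in fitting a polydisk into the ball of radius
   [r]. *)
- apply: (@squeezing_scale_le _ _ _ _ 1) => // [w|r w r0].
    by rewrite scale1r; exact: euclidean_ball_sub_polydisk.
  rewrite invr1 scale1r => /(euclidean_norm_lt n_gt0 (mulr_gt0 sV0 r0)).
  by rewrite mulVKf ?gt_eqF.
(* Here the loss comes from the dilation itself, which shrinks the unit polydisk into the unit
   ball. *)
- apply: (@squeezing_scale_le _ _ _ _ s^-1) => // [|w w1|r w r0].
  + by rewrite gt_eqF.
  + have /(euclidean_norm_lt n_gt0 sV0) : polydisk s^-1 (s^-1%:C%C *: w).
      by move=> i; rewrite normcZ_real ?ltW // gtr_pMr.
    by rewrite -/s divff ?gt_eqF.
  + move=> /euclidean_ball_sub_polydisk wr i.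
    by rewrite invrK normcZ_real ?ltW // -ltr_pdivlMl.
Qed.
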